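(* Let $(G,\mathcal{U},\varphi)$ be a self-similar ultragraph. If for any $g\in G\setminus\{1_G\}$, each set of the form $\{v\}\mathbf{SF}_g$ or $s(e)\mathbf{SF}_g$, where $v\in U^0$ and $e\in\mathcal{U}^1$, has finitely many minimal elements, then the tight groupoid $\mathcal{G}_{\mathrm{tight}}(\mathcal{S}_{G,\mathcal{U}})$ is Hausdorff.
   Context: **Ultragraphs.** An ultragraph $\mathcal{U}=(U^0,\mathcal{U}^1,r,s)$ consists of a set $U^0$ of vertices, a set $\mathcal{U}^1$ of edges and maps $r,s:\mathcal{U}^1\to P(U^0)\setminus\{\emptyset\}$ ($P$ = power set) such that $r(e)$ is a singleton for every $e$. Standing assumption: $\mathcal{U}$ is row-finite without sources, i.e. $\{e\in\mathcal{U}^1: r(e)=\{v\}\}$ is nonempty and finite for all $v\in U^0$. $\mathcal{U}^0$ denotes the smallest subset of $P(U^0)$ containing $\emptyset$, all $\{v\}$ ($v\in U^0$), all $s(e)$ ($e\in\mathcal{U}^1$), and closed under finite $\cap,\cup,\setminus$. A path of length $n\ge1$ is a sequence $\alpha=e_1\cdots e_n$ of edges with $r(e_{i+1})\subseteq s(e_i)$; $r(\alpha)=r(e_1)$, $s(\alpha)=s(e_n)$, $|\alpha|=n$; $\mathcal{U}^{\ge1}$ is the set of all such paths. Concatenation $\alpha\beta$ is defined when $r(\beta)\subseteq s(\alpha)$. **Self-similar ultragraph.** A triple $(G,\mathcal{U},\varphi)$ where $\mathcal{U}=(U^0,\mathcal{U}^1,r,s)$ is a row-finite ultragraph without sources,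 $G$ is a countable discrete group with identity $1_G$ acting on $U^0\sqcup\mathcal{U}^1$ by ultragraph automorphisms (bijections preserving $U^0$ and $\mathcal{U}^1$ with $r(g\cdot e)=g\cdot r(e)$, $s(g\cdot e)=g\cdot s(e)$, where $g\cdot A=\{g\cdot v:v\in A\}$), and $\varphi:G\times\mathcal{U}^1\to G$ satisfies $\varphi(gh,e)=\varphi(g,h\cdot e)\varphi(h,e)$ and $\varphi(g,e)\cdot s(e)\subseteq g\cdot s(e)$. Extend to paths inductively by $g\cdot(\alpha_1\alpha_2)=(g\cdot\alpha_1)(\varphi(g,\alpha_1)\cdot\alpha_2)$, $\varphi(g,\alpha_1\alpha_2)=\varphi(\varphi(g,\alpha_1),\alpha_2)$. **Strongly fixed paths.** $\alpha\in\mathcal{U}^{\ge1}$ is strongly fixed by $g\in G$ if $g\cdot\alpha=\alpha$ and $\varphi(g,\alpha)=1_G$. $\mathbf{SF}_g$ is the set of paths strongly fixed by $g$, and $A\mathbf{SF}_g=\{\gamma\in\mathbf{SF}_g:r(\gamma)\subseteq A\}$ for $A\in\mathcal{U}^0$. An element of $A\mathbf{SF}_g$ is minimal if no proper initial subpath (of length $\ge1$) of it is strongly fixed by $g$. **The inverse semigroup $\mathcal{S}_{G,\mathcal{U}}$.** Add a universal path $\omega$ of length zero with $\omega\omega=\omega$, $\omega\alpha=\alpha\omega=\alpha$, $s(\omega)=r(\omega)=U^0$, $g\cdot\omega=\omega$, $\varphi(g,\omega)=g$; put $\mathcal{U}^\sharp=\{\omega\}\cup\mathcal{U}^{\ge1}$.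 Let $\mathcal{S}_{G,\mathcal{U}}=\{(\alpha,A,g,\beta):\alpha,\beta\in\mathcal{U}^\sharp, A\in\mathcal{U}^0, g\in G, \emptyset\ne A\subseteq s(\alpha)\cap g\cdot s(\beta)\}\cup\{0\}$, where $0$ is a zero element, with involution $(\alpha,A,g,\beta)^*=(\beta,g^{-1}\cdot A,g^{-1},\alpha)$, $0^*=0$, and product $(\alpha,A,g,\beta)(\gamma,B,h,\delta)$ equal to - $(\alpha(g\cdot\varepsilon),\ s(g\cdot\varepsilon)\cap(\varphi(g,\varepsilon)\cdot B),\ \varphi(g,\varepsilon)h,\ \delta)$ if $\gamma=\beta\varepsilon$, $\varepsilon\in\mathcal{U}^{\ge1}$, $g\cdot r(\varepsilon)\subseteq A$; - $(\alpha,\ A\cap(g\varphi(h^{-1},\varepsilon)^{-1}\cdot s(h^{-1}\cdot\varepsilon)),\ g\varphi(h^{-1},\varepsilon)^{-1},\ \delta(h^{-1}\cdot\varepsilon))$ if $\beta=\gamma\varepsilon$, $\varepsilon\in\mathcal{U}^{\ge1}$, $r(\varepsilon)\subseteq B$; - $(\alpha,A\cap(g\cdot B),gh,\delta)$ if $\gamma=\beta$ and $A\cap(g\cdot B)\neq\emptyset$; - $0$ otherwise. This is an inverse semigroup with zero. **Tight groupoid.** Let $\mathcal{S}$ be an inverse semigroup with zero, $\mathcal{E}(\mathcal{S})$ its idempotents, with natural order $s\le t$ iff $s=te$ for some idempotent $e$. A filter in $\mathcal{E}(\mathcal{S})$ is a nonempty subset closed under products and upward closed; $\widehat{\mathcal{E}}_0(\mathcal{S})$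 is the set of filters not containing $0$, with the topology generated by the sets $\{\mathcal{F}:e\in\mathcal{F},\ e_1,\dots,e_n\notin\mathcal{F}\}$. Ultrafilters are the maximal filters not containing $0$; the tight spectrum $\widehat{\mathcal{E}}_{\mathrm{tight}}(\mathcal{S})$ is the closure of the set of ultrafilters in $\widehat{\mathcal{E}}_0(\mathcal{S})$. For $s\in\mathcal{S}$, $\theta_s$ maps $\{\mathcal{F}\in\widehat{\mathcal{E}}_{\mathrm{tight}}(\mathcal{S}):s^*s\in\mathcal{F}\}$ to $\{\mathcal{F}:ss^*\in\mathcal{F}\}$ by $\theta_s(\mathcal{F})=(s\mathcal{F}s^* )\uparrow$ (upward closure in $\mathcal{E}(\mathcal{S})$). $\mathcal{G}_{\mathrm{tight}}(\mathcal{S})$ is the groupoid of germs: classes $[s,\mathcal{F}]$ of pairs with $s^*s\in\mathcal{F}$, where $(s,\mathcal{F})\sim(t,\mathcal{F}')$ iff $\mathcal{F}=\mathcal{F}'$ and $se=te$ for some $e\in\mathcal{F}$; $[t,\theta_s(\mathcal{F})][s,\mathcal{F}]=[ts,\mathcal{F}]$, $[s,\mathcal{F}]^{-1}=[s^*,\theta_s(\mathcal{F})]$; topology with basis $[s,V]=\{[s,\mathcal{F}]:\mathcal{F}\in V\}$, $V$ open in $\{\mathcal{F}: s^*s\in\mathcal{F}\}$. *)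

(* Defs.v *)
From HB Require Import structures.
From mathcomp Require Import all_boot.
From mathcomp Require Import all_classical topology.

Set Implicit Arguments.
Unset Strict Implicit.
Unset Printing Implicit Defensive.

Local Open Scope classical_set_scope.
Local Open Scope group_scope.

HB.mixin Record isInverseSemigroup0 S & Semigroup S := {
  star : S -> S;
  szero : S;
  mul_starK : forall s : S, s * star s * s = s;
  star_mulK : forall s : S, star s * s * star s = star s;
  star_unique : forall s t : S, s * t * s = s -> t * s * t = t -> t = star s;
  mul0s : forall s : S, szero * s = szero;
  muls0 : forall s : S, s * szero = szero
}.

#[short(type="inverseSemigroup0Type")]
HB.structure Definition InverseSemigroup0 :=
  {S of isInverseSemigroup0 S & Semigroup S}.

Arguments szero {s} : rename.

Section InverseSemigroupTheory.
Variable S : inverseSemigroup0Type.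
Implicit Types (s t u e f : S).

Definition idem : set S := [set e | e * e = e].

Definition natle s t := exists2 e, idem e & s = t * e.

Lemma starK s : star (star s) = s.
Proof. by apply/esym/star_unique; [exact: star_mulK|exact: mul_starK]. Qed.

Lemma star_idem e : idem e -> star e = e.
Proof. by move=> ee; apply/esym/star_unique; rewrite !ee. Qed.

Lemma idemM e f : idem e -> idem f -> idem (e * f).
Proof.
move=> ee ff; set x := star (e * f).
have x1 : e * f * x * (e * f) = e * f by exact: mul_starK.
have x2 : x * (e * f) * x = x by exact: star_mulK.
have fxe : f * x * e = x.
  apply: star_unique.
    have -> : e * f * (f * x * e) * (e * f)
            = e * (f * f) * x * ((e * e) * f) by rewrite !mulgA.
    by rewrite ee ff.
  have -> : f * x * e * (e * f) * (f * x * e)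
          = f * (x * ((e * e) * (f * f)) * x) * e by rewrite !mulgA.
  by rewrite ee ff x2.
have xx : idem x.
  rewrite /idem /= -{1}fxe -{2}fxe.
  have -> : f * x * e * (f * x * e) = f * (x * (e * f) * x) * e
    by rewrite !mulgA.
  by rewrite x2.
by rewrite /idem /= -[e * f]starK -/x star_idem.
Qed.

Lemma idemC e f : idem e -> idem f -> e * f = f * e.
Proof.
move=> ee ff; have ef := idemM ee ff; have fe := idemM ff ee.
rewrite -[LHS]star_idem //; apply/esym/star_unique.
  have -> : e * f * (f * e) * (e * f) = e * (f * f) * (e * e) * f
    by rewrite !mulgA.
  by rewrite ee ff -[RHS]ef !mulgA.
have -> : f * e * (e * f) * (f * e) = f * (e * e) * (f * f) * e
  by rewrite !mulgA.
by rewrite ee ff -[RHS]fe !mulgA.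
Qed.

Lemma idem_starM s : idem (star s * s).
Proof. by rewrite /idem /= mulgA star_mulK. Qed.

Lemma idem_Mstar s : idem (s * star s).
Proof. by rewrite /idem /= mulgA mul_starK. Qed.

Lemma starM s t : star (s * t) = star t * star s.
Proof.
apply/esym/star_unique.
  have -> : s * t * (star t * star s) * (s * t)
          = s * ((t * star t) * (star s * s)) * t by rewrite !mulgA.
  rewrite (idemC (idem_Mstar t) (idem_starM s)).
  have -> : s * (star s * s * (t * star t)) * t
          = (s * star s * s) * (t * star t * t) by rewrite !mulgA.
  by rewrite !mul_starK.
have -> : star t * star s * (s * t) * (star t * star s)
        = star t * ((star s * s) * (t * star t)) * star s by rewrite !mulgA.
rewrite (idemC (idem_starM s) (idem_Mstar t)).
have -> : star t * (t * star t * (star s * s)) * star s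
        = (star t * t * star t) * (star s * s * star s) by rewrite !mulgA.
by rewrite !star_mulK.
Qed.

Lemma idem_conj s e : idem e -> idem (s * e * star s).
Proof.
move=> ee; rewrite /idem /=.
have -> : s * e * star s * (s * e * star s)
        = s * (e * (star s * s)) * e * star s by rewrite !mulgA.
rewrite (idemC ee (idem_starM s)).
have -> : s * (star s * s * e) * e * star s
        = (s * star s * s) * (e * e) * star s by rewrite !mulgA.
by rewrite mul_starK ee.
Qed.

Lemma idem_star e : idem e -> idem (star e).
Proof. by move=> ee; rewrite star_idem. Qed.

Lemma idem0 : idem szero.
Proof. exact: mul0s. Qed.

Lemma idem_swap s e : idem e -> e * s = s * (star s * e * s).
Proof.
move=> ee; rewrite -{1}(mul_starK s).
have -> : e * (s * star s * s) = (e * (s * star s)) * s by rewrite !mulgA.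
by rewrite (idemC ee (idem_Mstar s)) !mulgA.
Qed.

Lemma idem_conjV s e : idem e -> idem (star s * e * s).
Proof. by move=> ee; rewrite -{2}[s]starK; exact: idem_conj. Qed.

Lemma natle_idemE e f : idem e -> idem f -> natle e f <-> e = f * e.
Proof.
move=> ee ff; split=> [[g gg ->]|->]; first by rewrite mulgA ff.
by exists e => //; rewrite mulgA ff.
Qed.

Lemma natlexx s : natle s s.
Proof. by exists (star s * s); [exact: idem_starM|rewrite mulgA mul_starK]. Qed.

Definition is_filter (F : set S) :=
  [/\ F `<=` idem, F !=set0,
      forall e f, F e -> F f -> F (e * f) &
      forall e f, F e -> idem f -> natle e f -> F f].

End InverseSemigroupTheory.

Record efilter (S : inverseSemigroup0Type) := EFilter {
  efilter_mem :> S -> Prop;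
  efilter_filter : is_filter efilter_mem;
  efilter_n0 : ~ efilter_mem szero
}.

HB.instance Definition _ (S : inverseSemigroup0Type) :=
  gen_eqMixin (efilter S).
HB.instance Definition _ (S : inverseSemigroup0Type) :=
  gen_choiceMixin (efilter S).

Definition basic_nbhs (S : inverseSemigroup0Type) (e : S) (l : seq S) :
  set (efilter S) := [set F | F e /\ forall f, f \in l -> ~ F f].

Definition basic_sets (S : inverseSemigroup0Type) : set (set (efilter S)) :=
  [set U | exists e l, [/\ idem e, {in l, forall f, idem f} &
                           U = basic_nbhs e l]].

Lemma basic_sets_cover (S : inverseSemigroup0Type) :
  \bigcup_(U in @basic_sets S) id U = setT.
Proof.
apply/seteqP; split=> // F _; have [Fi [e Fe] _ _] := efilter_filter F.
exists (basic_nbhs e [::]); last by split.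
by exists e, [::]; split=> //; exact: Fi.
Qed.

Lemma basic_sets_join (S : inverseSemigroup0Type) (U V : set (efilter S)) F :
  basic_sets U -> basic_sets V -> id U F -> id V F ->
  exists W, [/\ basic_sets W, id W F & id W `<=` id U `&` id V].
Proof.
move=> [e [l [ei li ->]]] [f [m [fi mi ->]]] [Fe Fl] [Ff Fm].
exists (basic_nbhs (e * f) (l ++ m)); split.
- exists (e * f), (l ++ m); split=> // [|x]; first exact: idemM.
  by rewrite mem_cat => /orP[/li|/mi].
- split=> [|x]; first by have [_ _ + _] := efilter_filter F; apply.
  by rewrite mem_cat => /orP[/Fl|/Fm].
- move=> K [Kef Klm]; have [Ki _ _ Ku] := efilter_filter K.
  split; split.
  + by apply: Ku Kef _ _ => //; exists f.
  + by move=> x xl; apply: Klm; rewrite mem_cat xl.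
  + by apply: Ku Kef _ _ => //; exists e => //; rewrite idemC.
  + by move=> x xm; apply: Klm; rewrite mem_cat xm orbT.
Qed.

HB.instance Definition _ (S : inverseSemigroup0Type) :=
  @isBaseTopological.Build (efilter S) (set (efilter S)) (@basic_sets S) id
    (@basic_sets_cover S) (@basic_sets_join S).

Section TightSpectrum.
Variable S : inverseSemigroup0Type.
Implicit Types (s t u e f : S).

Lemma basic_open (U : set (efilter S)) : basic_sets U -> open U.
Proof.
move=> bU; exists [set U]; first by move=> _ ->.
by rewrite bigcup_set1.
Qed.

Lemma open_basic (U : set (efilter S)) F : open U -> U F ->
  exists V, [/\ basic_sets V, V F & V `<=` U].
Proof.
move=> [D DU <-] [V DV VF]; exists V; split=> //; first exact: DU.
by move=> K VK; exists V.
Qed.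

Definition ultrafilters : set (efilter S) :=
  [set F : efilter S | forall K : efilter S, (forall e, F e -> K e) -> K = F].

Definition tight_spectrum : set (efilter S) := closure ultrafilters.

Definition tight := set_type tight_spectrum.

HB.instance Definition _ := Topological.on tight.

Definition tight_filter (F : tight) : efilter S := set_val F.
Coercion tight_filter : tight >-> efilter.

Lemma efilter_ext (F K : efilter S) : (forall e, F e <-> K e) -> F = K.
Proof.
case: F K => [F fF F0] [K fK K0] /= FK.
have E : F = K by apply/funext => e; apply/propext.
by subst K; congr EFilter; exact: Prop_irrelevance.
Qed.

Section FilterTheory.
Variable F : efilter S.

Lemma filt_idem e : F e -> idem e.
Proof. by have [Fi _ _ _] := efilter_filter F; exact: Fi. Qed.

Lemma filtM e f : F e -> F f -> F (e * f).
Proof. by have [_ _ + _] := efilter_filter F; apply. Qed.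

Lemma filtS e f : F e -> idem f -> e = f * e -> F f.
Proof.
move=> Fe fi ef; have [_ _ _ Fu] := efilter_filter F.
by apply: (Fu _ _ Fe fi); exact/(natle_idemE (filt_idem Fe) fi).
Qed.

Lemma filtMl e f : idem e -> idem f -> F (e * f) -> F e.
Proof. by move=> ei fi H; apply: (filtS H ei); rewrite mulgA ei. Qed.

Lemma filtMr e f : idem e -> idem f -> F (e * f) -> F f.
Proof. by move=> ei fi; rewrite idemC //; exact: filtMl. Qed.

End FilterTheory.

Definition theta_set s (F : set S) : set S :=
  [set f | idem f /\ exists2 e, F e & natle (s * e * star s) f].

Lemma theta_setE s (F : efilter S) f : F (star s * s) ->
  theta_set s F f <-> idem f /\ F (star s * f * s).
Proof.
move=> Fs; split=> [[fi [e Fe]]|[fi Ff]].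
  have ei := filt_idem Fe.
  move=> /(natle_idemE (idem_conj s ei) fi) sef; split=> //.
  have Fe' := filtM (filtM Fs Fe) Fs.
  apply: (filtS Fe'); first exact: idem_conjV.
  have -> : star s * f * s * (star s * s * e * (star s * s))
          = star s * f * (s * star s * s) * e * star s * s by rewrite !mulgA.
  rewrite mul_starK.
  have -> : star s * f * s * e * star s * s
          = star s * (f * (s * e * star s)) * s by rewrite !mulgA.
  by rewrite -sef !mulgA.
split=> //; exists (star s * f * s) => //.
have fs := idem_conjV s fi.
apply/(natle_idemE (idem_conj s fs) fi).
rewrite -idem_swap //.
by rewrite !mulgA fi.
Qed.

Lemma theta_filter s (F : efilter S) : F (star s * s) ->
  is_filter (theta_set s F).
Proof.
move=> Fs; split.
- by move=> f [].
- exists (s * star s); apply/theta_setE => //; split; first exact: idem_Mstar.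
  by rewrite !mulgA star_mulK.
- move=> e f /(theta_setE _ Fs)[ei Fe] /(theta_setE _ Fs)[fi Ff].
  apply/theta_setE => //; split; first exact: idemM.
  have -> : star s * (e * f) * s = star s * e * s * (star s * f * s).
    have -> : star s * e * s * (star s * f * s)
            = star s * e * (s * star s * f) * s by rewrite !mulgA.
    rewrite (idemC (idem_Mstar s) fi).
    have -> : star s * e * (f * (s * star s)) * s
            = star s * e * f * (s * star s * s) by rewrite !mulgA.
    by rewrite mul_starK !mulgA.
  exact: filtM.
- move=> e f /(theta_setE _ Fs)[ei Fe] fi /(natle_idemE ei fi) ef.
  apply/theta_setE => //; split=> //.
  apply: (filtS Fe); first exact: idem_conjV.
  have -> : star s * f * s * (star s * e * s)
          = star s * f * ((s * star s) * e) * s by rewrite !mulgA.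
  rewrite (idemC (idem_Mstar s) ei).
  have -> : star s * f * (e * (s * star s)) * s
          = star s * (f * e) * (s * star s * s) by rewrite !mulgA.
  by rewrite mul_starK -ef.
Qed.

Lemma theta_n0 s (F : efilter S) : F (star s * s) -> ~ theta_set s F szero.
Proof.
move=> Fs /(theta_setE _ Fs)[_]; rewrite muls0 mul0s.
exact: efilter_n0.
Qed.

Definition etheta s (F : efilter S) (Fs : F (star s * s)) : efilter S :=
  EFilter (theta_filter Fs) (theta_n0 Fs).

Lemma ethetaE s (F : efilter S) (Fs : F (star s * s)) f :
  etheta Fs f <-> idem f /\ F (star s * f * s).
Proof. exact: theta_setE. Qed.

Lemma etheta_dom s (F : efilter S) (Fs : F (star s * s)) :
  etheta Fs (star (star s) * star s).
Proof.
by rewrite starK; apply/ethetaE; split; [exact: idem_Mstar|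
  rewrite !mulgA star_mulK].
Qed.

Lemma ethetaK s (F : efilter S) (Fs : F (star s * s)) :
  etheta (etheta_dom Fs) = F.
Proof.
apply: efilter_ext => f; split.
  move=> /ethetaE[fi]; rewrite starK => /ethetaE[_].
  have -> : star s * (s * f * star s) * s
          = (star s * s) * f * (star s * s) by rewrite !mulgA.
  move=> H; have si := idem_starM s.
  exact: filtMr (filtMl (idemM si fi) si H).
move=> Ff; have fi := filt_idem Ff.
apply/ethetaE; split=> //; rewrite starK; apply/ethetaE.
split; first exact: (idem_conj s fi).
have -> : star s * (s * f * star s) * s
        = (star s * s) * f * (star s * s) by rewrite !mulgA.
exact: (filtM (filtM Fs Ff) Fs).
Qed.

Lemma etheta_ultra s (F : efilter S) (Fs : F (star s * s)) :
  ultrafilters F -> ultrafilters (etheta Fs).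
Proof.
move=> uF K FK.
have Ks : K (star (star s) * star s) by apply: FK; exact: etheta_dom.
have KF : etheta Ks = F.
  apply: uF => e Fe; apply/ethetaE; split; first exact: filt_idem Fe.
  apply: FK; apply/ethetaE; rewrite starK.
  split; first exact: (idem_conj s (filt_idem Fe)).
  have -> : star s * (s * e * star s) * s
          = (star s * s) * e * (star s * s) by rewrite !mulgA.
  exact: (filtM (filtM Fs Fe) Fs).
apply: efilter_ext => f; split=> [Kf|]; last exact: FK.
have fi := filt_idem Kf; apply/ethetaE; split=> //.
rewrite -KF; apply/ethetaE; split; first exact: idem_conjV.
rewrite starK.
have -> : s * (star s * f * s) * star s
        = (s * star s) * f * (s * star s) by rewrite !mulgA.
by have := Ks; rewrite {1}starK => K1; exact: (filtM (filtM K1 Kf) K1).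
Qed.

Lemma tight_spectrumP (F : efilter S) : tight_spectrum F <->
  forall e (l : seq S), idem e -> {in l, forall f, idem f} ->
    F e -> (forall f, f \in l -> ~ F f) ->
    exists K : efilter S, [/\ ultrafilters K, K e & forall f, f \in l -> ~ K f].
Proof.
split=> [cF e l ei li Fe Fl|H].
  have [|K [uK [Ke Kl]]] := cF (basic_nbhs e l); last by exists K.
  by apply: open_nbhs_nbhs; split=> //; apply: basic_open; exists e, l.
move=> B; rewrite nbhsE => -[U [oU UF] UB].
have [_ [[e [l [ei li ->]]] [Fe Fl] VU]] := open_basic oU UF.
have [K [uK Ke Kl]] := H e l ei li Fe Fl.
by exists K; split=> //; apply/UB/VU.
Qed.

Lemma etheta_tight s (F : efilter S) (Fs : F (star s * s)) :
  tight_spectrum F -> tight_spectrum (etheta Fs).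
Proof.
move=> /tight_spectrumP tF; apply/tight_spectrumP => e l ei li.
move=> /ethetaE[_ Fe] Fl.
have si := idem_starM s; have ci := idem_conjV s ei.
have [||||K [uK Ke Kl]] :=
    tF (star s * s * (star s * e * s)) [seq star s * f * s | f <- l].
- exact: idemM.
- by move=> _ /mapP[f /li fi ->]; exact: idem_conjV.
- by apply: filtM.
- by move=> _ /mapP[f fl ->] Ff; apply: (Fl f fl); apply/ethetaE; split=> //;
    exact: li.
have Ks := filtMl si ci Ke; have Ke' := filtMr si ci Ke.
exists (etheta Ks); split; first exact: etheta_ultra.
  exact/ethetaE.
by move=> f fl /ethetaE[_]; apply: Kl; apply: map_f.
Qed.


Lemma tight_ext (F K : tight) : (forall e, F e <-> K e) -> F = K.
Proof. by move=> /efilter_ext FK; apply: val_inj. Qed.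

Definition theta s (F : tight) (Fs : F (star s * s)) : tight :=
  exist _ (etheta Fs) (mem_set (@etheta_tight s F Fs (set_valP F))).

Lemma thetaE s (F : tight) (Fs : F (star s * s)) f :
  theta Fs f <-> idem f /\ F (star s * f * s).
Proof. exact: ethetaE. Qed.

Lemma theta_dom s (F : tight) (Fs : F (star s * s)) :
  theta Fs (star (star s) * star s).
Proof. exact: etheta_dom. Qed.

Lemma thetaK s (F : tight) (Fs : F (star s * s)) : theta (theta_dom Fs) = F.
Proof.
by apply: val_inj; rewrite /= -[RHS](ethetaK Fs); exact: efilter_ext.
Qed.

End TightSpectrum.

(* A groupoid in the sense of a set with a partial product and an inverse;
   [gmul] is only meaningful on composable pairs. *)
HB.mixin Record isGroupoid A := {
  composable : A -> A -> Prop;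
  gmul : A -> A -> A;
  ginv : A -> A;
  ginvK : involutive ginv;
  gmulA : forall a b c : A, composable a b -> composable b c ->
    [/\ composable (gmul a b) c, composable a (gmul b c) &
        gmul (gmul a b) c = gmul a (gmul b c)];
  ginv_composable : forall a : A, composable (ginv a) a;
  gmulKl : forall a b : A, composable a b -> gmul (ginv a) (gmul a b) = b;
  gmulKr : forall a b : A, composable b a -> gmul (gmul b a) (ginv a) = b
}.

(* A groupoid carrying a topology; its operations need not be continuous. *)
#[short(type="topGroupoidType")]
HB.structure Definition TopGroupoid := {A of Topological A & isGroupoid A}.

Record germ_pair (S : inverseSemigroup0Type) := GermPair {
  germ_elt : S;
  germ_filter : tight S;
  germ_dom : germ_filter (star germ_elt * germ_elt)
}.

HB.instance Definition _ (S : inverseSemigroup0Type) :=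
  gen_eqMixin (germ_pair S).
HB.instance Definition _ (S : inverseSemigroup0Type) :=
  gen_choiceMixin (germ_pair S).

Section Germs.
Variable S : inverseSemigroup0Type.
Implicit Types (s t u e f : S) (p q r : germ_pair S).

Definition germ_eq p q :=
  germ_filter p = germ_filter q /\
  exists2 e, germ_filter p e & germ_elt p * e = germ_elt q * e.

Definition germ_rel p q := `[< germ_eq p q >].

Lemma germ_rel_refl : reflexive germ_rel.
Proof.
move=> p; apply/asboolP; split=> //.
by exists (star (germ_elt p) * germ_elt p); first exact: germ_dom.
Qed.

Lemma germ_rel_sym : symmetric germ_rel.
Proof.
have H p q : germ_eq p q -> germ_eq q p.
  by move=> [Fpq [e Fe pq]]; split=> //; exists e => //; rewrite -Fpq.
by move=> p q; apply/asboolP/asboolP; exact: H.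
Qed.

Lemma germ_rel_trans : transitive germ_rel.
Proof.
move=> q p r /asboolP[Fpq [e Fe pq]] /asboolP[Fqr [f Ff qr]].
rewrite -Fpq in Ff; apply/asboolP; split; first by rewrite Fpq.
have ei := filt_idem Fe; have fi := filt_idem Ff.
exists (e * f); first exact: (filtM Fe Ff).
by rewrite mulgA pq -mulgA (idemC ei fi) mulgA qr !mulgA.
Qed.

Canonical germ_equiv :=
  EquivRel germ_rel germ_rel_refl germ_rel_sym germ_rel_trans.

Definition tight_groupoid := {eq_quot germ_equiv}%qT.

HB.instance Definition _ := Choice.on tight_groupoid.
HB.instance Definition _ := Quotient.on tight_groupoid.

Definition germ p : tight_groupoid := (\pi p)%qT.

Lemma germP p q : germ p = germ q <-> germ_eq p q.
Proof.
split=> [/eqmodP/asboolP //|pq]; apply/eqmodP; exact/asboolP.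
Qed.

Lemma germ_repr (a : tight_groupoid) : germ (repr a) = a.
Proof. exact: reprK. Qed.

(* The set [s, V]; the filters of V should lie in the domain of theta s. *)
Definition germ_nbhs s (V : set (tight S)) : set tight_groupoid :=
  [set germ p | p in [set p | germ_elt p = s /\ V (germ_filter p)]].

Definition germ_basis : set (set tight_groupoid) :=
  [set U | exists s (W : set (tight S)), open W /\
     U = germ_nbhs s (W `&` [set F : tight S | F (star s * s)])].

Lemma tight_open e : idem e -> open [set F : tight S | F e].
Proof.
move=> ei; exists (basic_nbhs e [::]).
  by apply: basic_open; exists e, [::].
by apply/seteqP; split=> [F [Fe _]|F Fe].
Qed.

Lemma germ_basis_cover : \bigcup_(U in germ_basis) id U = setT.
Proof.
apply/seteqP; split=> // a _; rewrite -[a]germ_repr; set p := repr a.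
exists (germ_nbhs (germ_elt p)
         (setT `&` [set F : tight S | F (star (germ_elt p) * germ_elt p)])).
  by exists (germ_elt p), setT; split=> //; exact: openT.
by exists p => //; split=> //; split=> //; exact: germ_dom.
Qed.

Lemma germ_basis_join (U V : set tight_groupoid) a :
  germ_basis U -> germ_basis V -> id U a -> id V a ->
  exists W, [/\ germ_basis W, id W a & id W `<=` id U `&` id V].
Proof.
move=> [s [U' [oU ->]]] [t [V' [oV ->]]].
move=> [p [ps [Up Dp]] pa] [q [qt [Vq Dq]] qa]; subst a.
have /germP[Fqp [e Fe qpe]] := qa; rewrite -Fqp in Dp Up.
rewrite ps qt in qpe; rewrite /= Fqp in Fe.
have ei := filt_idem Fe.
pose W := (U' `&` V') `&` [set F : tight S | F e] `&`
          [set F : tight S | F (star t * t)].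
exists (germ_nbhs s (W `&` [set F : tight S | F (star s * s)])); split.
- exists s, W; split=> //.
  apply: openI; last exact: tight_open (idem_starM t).
  by apply: openI; [exact: openI|exact: tight_open].
- exists p => //; split=> //; rewrite /= -Fqp; do !split => //.
  by rewrite Fqp.
- move=> _ [x [xs [[[[Ux Vx] xe] xt] xd]] <-]; split.
    by exists x.
  exists (GermPair xt); first by do !split.
  by apply/germP; split=> //; exists e => //; rewrite xs.
Qed.

HB.instance Definition _ :=
  @isBaseTopological.Build tight_groupoid (set tight_groupoid) germ_basis id
    germ_basis_cover germ_basis_join.

Definition pair_target p : tight S := theta (@germ_dom S p).

Lemma pair_target_eq p q : germ_eq p q -> pair_target p = pair_target q.
Proof.
have H p' q' f : germ_eq p' q' -> pair_target p' f -> pair_target q' f.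
  move=> [Fpq [e Fe pq]] /thetaE[fi Ff]; apply/thetaE; split=> //.
  rewrite -Fpq; have ei := filt_idem Fe.
  have E s : e * (star s * f * s) * e = star (s * e) * f * (s * e).
    by rewrite starM (star_idem ei) !mulgA.
  have := filtM (filtM Fe Ff) Fe; rewrite E pq -E => F1.
  have qi := idem_conjV (germ_elt q') fi.
  exact: filtMr (filtMl (idemM ei qi) ei F1).
move=> pq; apply: tight_ext => f; split; first exact: H.
apply: H; exact/germP/esym/germP.
Qed.

Definition pair_composable p q := germ_filter p = pair_target q.

Lemma pair_mul_dom p q : pair_composable p q ->
  germ_filter q (star (germ_elt p * germ_elt q) * (germ_elt p * germ_elt q)).
Proof.
move=> pq; have := germ_dom p; rewrite pq => /thetaE[_].
by rewrite starM !mulgA.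
Qed.

Definition pair_mul p q (pq : pair_composable p q) : germ_pair S :=
  GermPair (pair_mul_dom pq).

Definition pair_inv p : germ_pair S := GermPair (theta_dom (@germ_dom S p)).

Definition germ_composable (a b : tight_groupoid) :=
  pair_composable (repr a) (repr b).

Definition germ_mul (a b : tight_groupoid) : tight_groupoid :=
  if pselect (germ_composable a b) is left ab then germ (pair_mul ab) else a.

Definition germ_inv (a : tight_groupoid) := germ (pair_inv (repr a)).

Lemma germ_ind (P : tight_groupoid -> Prop) :
  (forall p, P (germ p)) -> forall a, P a.
Proof. by move=> H a; rewrite -[a]germ_repr. Qed.

Lemma repr_germ p : germ_eq (repr (germ p)) p.
Proof. by apply/germP; exact: germ_repr. Qed.

Lemma germ_composableE p q :
  germ_composable (germ p) (germ q) <-> pair_composable p q.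
Proof.
rewrite /germ_composable /pair_composable.
have [-> _] := repr_germ p.
by rewrite (pair_target_eq (repr_germ q)).
Qed.

Lemma pair_mul_eq p q p' q' (pq : pair_composable p q)
    (pq' : pair_composable p' q') :
  germ_eq p p' -> germ_eq q q' -> germ_eq (pair_mul pq) (pair_mul pq').
Proof.
move=> [Fp [e Fe pe]] [Fq [f Ff qf]]; split=> //=.
have ei := filt_idem Fe; have fi := filt_idem Ff.
move: Fe; rewrite pq => /thetaE[_ Fe].
have ci := idem_conjV (germ_elt q) ei.
exists (star (germ_elt q) * e * germ_elt q * f); first exact: (filtM Fe Ff).
set t := germ_elt p in pe *; set t' := germ_elt p' in pe *.
set s := germ_elt q in qf ci *; set s' := germ_elt q' in qf *.
transitivity (t * (e * s) * f); first by rewrite [e * s]idem_swap // !mulgA.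
rewrite [t * _]mulgA pe -[t' * e * s]mulgA [e * s]idem_swap //.
rewrite (idemC ci fi) -[t' * _ * f]mulgA -[s * _ * f]mulgA (idemC ci fi).
by rewrite [s * _]mulgA qf !mulgA.
Qed.

Lemma germ_mulE p q (pq : pair_composable p q) :
  germ_mul (germ p) (germ q) = germ (pair_mul pq).
Proof.
rewrite /germ_mul; case: pselect => [pq'|/germ_composableE //].
by apply/germP/pair_mul_eq; exact: repr_germ.
Qed.

Lemma pair_inv_eq p q : germ_eq p q -> germ_eq (pair_inv p) (pair_inv q).
Proof.
move=> pq; split; first exact: pair_target_eq.
have [Fpq [e Fe pqe]] := pq; have ei := filt_idem Fe.
set s := germ_elt p in pqe *; set t := germ_elt q in pqe *.
exists (s * e * star s).
  apply/thetaE; split; first exact: idem_conj.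
  rewrite -/s.
  have -> : star s * (s * e * star s) * s = (star s * s) * e * (star s * s)
    by rewrite !mulgA.
  exact: (filtM (filtM (germ_dom p) Fe) (germ_dom p)).
have E x : star x * (x * e * star x) = e * star x.
  rewrite !mulgA (idemC (idem_starM x) ei) -!mulgA.
  by rewrite [star x * _]mulgA star_mulK.
have C x : e * star x = star (x * e) by rewrite starM (star_idem ei).
have D : s * e * star s = t * e * star t.
  have F x : x * e * star x = (x * e) * star (x * e).
    by rewrite -C mulgA -[x * e * e]mulgA ei.
  by rewrite !F pqe.
by rewrite /= -/s -/t {2}D !E !C pqe.
Qed.

Lemma germ_invE p : germ_inv (germ p) = germ (pair_inv p).
Proof. by apply/germP/pair_inv_eq; exact: repr_germ. Qed.

Lemma germ_invK : involutive germ_inv.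
Proof.
elim/germ_ind => p; rewrite !germ_invE; apply/germP.
have E : germ_filter (pair_inv (pair_inv p)) = germ_filter p by exact: thetaK.
split=> //.
exists (star (germ_elt p) * germ_elt p); last by rewrite /= starK.
by rewrite E; exact: germ_dom.
Qed.

Lemma pair_mul_target p q (pq : pair_composable p q) :
  pair_target (pair_mul pq) = pair_target p.
Proof.
apply: tight_ext => f; split=> /thetaE[fi Ff]; apply/thetaE; split=> //.
  rewrite pq; apply/thetaE; split; first exact: idem_conjV.
  by move: Ff; rewrite /= starM !mulgA.
by move: Ff; rewrite pq => /thetaE[_]; rewrite /= starM !mulgA.
Qed.

Lemma germ_mulA a b c : germ_composable a b -> germ_composable b c ->
  [/\ germ_composable (germ_mul a b) c, germ_composable a (germ_mul b c) &
      germ_mul (germ_mul a b) c = germ_mul a (germ_mul b c)].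
Proof.
elim/germ_ind: a => p; elim/germ_ind: b => q; elim/germ_ind: c => r.
move=> /germ_composableE pq /germ_composableE qr.
rewrite (germ_mulE pq) (germ_mulE qr).
have pq_r : pair_composable (pair_mul pq) r by [].
have p_qr : pair_composable p (pair_mul qr).
  by rewrite /pair_composable pair_mul_target.
split; [exact/germ_composableE|exact/germ_composableE|].
rewrite (germ_mulE pq_r) (germ_mulE p_qr); apply/germP; split=> //.
exists (star (germ_elt r) * germ_elt r); first exact: germ_dom.
by rewrite /= !mulgA.
Qed.

Lemma pair_inv_composable p : pair_composable (pair_inv p) p.
Proof. by []. Qed.

Lemma germ_inv_composable a : germ_composable (germ_inv a) a.
Proof. by elim/germ_ind: a => p; rewrite germ_invE; exact/germ_composableE. Qed.

Lemma germ_mulKl a b : germ_composable a b ->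
  germ_mul (germ_inv a) (germ_mul a b) = b.
Proof.
elim/germ_ind: a => p; elim/germ_ind: b => q /germ_composableE pq.
rewrite germ_invE (germ_mulE pq).
have H : pair_composable (pair_inv p) (pair_mul pq).
  by rewrite /pair_composable pair_mul_target.
rewrite (germ_mulE H); apply/germP; split=> //=.
have := germ_dom p; rewrite pq => /thetaE[ti Ft].
set s := germ_elt q in Ft *; set t := germ_elt p in ti Ft *.
exists (star s * (star t * t) * s) => //.
rewrite -[RHS]idem_swap // [star t * _]mulgA -[LHS]mulgA -idem_swap //.
by rewrite mulgA ti.
Qed.

Lemma germ_mulKr a b : germ_composable b a ->
  germ_mul (germ_mul b a) (germ_inv a) = b.
Proof.
elim/germ_ind: a => p; elim/germ_ind: b => q /germ_composableE qp.
rewrite germ_invE (germ_mulE qp).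
have H : pair_composable (pair_mul qp) (pair_inv p).
  by rewrite /pair_composable /pair_target thetaK.
rewrite (germ_mulE H); apply/germP; split=> //=.
set s := germ_elt p; set t := germ_elt q.
exists (s * star s); last by rewrite -!mulgA [star s * _]mulgA star_mulK.
apply: (proj2 (thetaE (@germ_dom S p) _)); split; first exact: idem_Mstar.
by rewrite -/s !mulgA star_mulK; exact: germ_dom.
Qed.

HB.instance Definition _ := isGroupoid.Build tight_groupoid
  germ_invK germ_mulA germ_inv_composable germ_mulKl germ_mulKr.

End Germs.

Record ultragraph := Ultragraph {
  vertex : Type;
  edge : Type;
  rng : edge -> set vertex;
  src : edge -> set vertex;
  rng_set1 : forall e, exists v, rng e = [set v];
  src_neq0 : forall e, src e !=set0
}.

Definition row_finite_no_sources (U : ultragraph) :=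
  forall v : vertex U, [set e : edge U | rng e = [set v]] !=set0 /\
                       finite_set [set e : edge U | rng e = [set v]].

Section Ultragraph.
Variable U : ultragraph.
Implicit Types (v : vertex U) (e : edge U) (A B : set (vertex U)).
Implicit Types (p q : seq (edge U)).

(* The family of sets of vertices usually written U^0 with a calligraphic U. *)
Inductive genset : set (vertex U) -> Prop :=
| genset0 : genset set0
| genset1 v : genset [set v]
| genset_src e : genset (src e)
| gensetI A B of genset A & genset B : genset (A `&` B)
| gensetU A B of genset A & genset B : genset (A `|` B)
| gensetD A B of genset A & genset B : genset (A `\` B).

(* A path is encoded by its sequence of edges, and the universal path omega of
   length zero by the empty sequence. *)
Fixpoint is_path p : Prop :=
  if p is e :: q then
    (if q is f :: _ then rng f `<=` src e else True) /\ is_path q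
  else True.

Definition path_rng p : set (vertex U) := if p is e :: _ then rng e else setT.

Definition path_src p : set (vertex U) :=
  if p is e :: q then src (last e q) else setT.

Lemma path_src_cat p q : q <> [::] -> path_src (p ++ q) = path_src q.
Proof. by case: q => // e q _; case: p => //= f p; rewrite last_cat. Qed.

Lemma path_rng_cat p q : p <> [::] -> path_rng (p ++ q) = path_rng p.
Proof. by case: p. Qed.

Lemma is_path_catl p q : is_path (p ++ q) -> is_path p.
Proof.
elim: p => //= e p IH [ep /IH pp]; split=> //.
by case: p ep {IH pp}.
Qed.

Lemma is_path_catr p q : is_path (p ++ q) -> is_path q.
Proof. by elim: p => //= e p IH [_ /IH]. Qed.

Lemma is_path_cat p q : is_path p -> is_path q -> path_rng q `<=` path_src p ->
  is_path (p ++ q).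
Proof.
move=> + qq; elim: p => //= e p IH [ep pp] qp; split; last first.
  by apply: IH => //; case: p qp {ep pp}.
case: p ep qp {IH pp} => //= _; by case: q {qq}.
Qed.

Lemma genset_path p : p <> [::] -> genset (path_src p).
Proof. by case: p => // e p _; exact: genset_src. Qed.

End Ultragraph.

Record self_similar (G : groupType) (U : ultragraph) := SelfSimilar {
  act_v : G -> vertex U -> vertex U;
  act_e : G -> edge U -> edge U;
  phi : G -> edge U -> G;
  ss_row_finite : row_finite_no_sources U;
  ss_countable : countable [set: G];
  act_v1 : forall v, act_v 1 v = v;
  act_vM : forall g h v, act_v (g * h) v = act_v g (act_v h v);
  act_e1 : forall e, act_e 1 e = e;
  act_eM : forall g h e, act_e (g * h) e = act_e g (act_e h e);
  act_rng : forall g e, rng (act_e g e) = act_v g @` rng e;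
  act_src : forall g e, src (act_e g e) = act_v g @` src e;
  phiM : forall g h e, phi (g * h) e = phi g (act_e h e) * phi h e;
  phi_src : forall g e, act_v (phi g e) @` src e `<=` act_v g @` src e
}.

Section SelfSimilar.
Variables (G : groupType) (U : ultragraph) (X : self_similar G U).
Implicit Types (g h : G) (v : vertex U) (e : edge U) (A B : set (vertex U)).
Implicit Types (p q : seq (edge U)).

Definition act_s g A : set (vertex U) := act_v X g @` A.

Fixpoint act_p g p : seq (edge U) :=
  if p is e :: q then act_e X g e :: act_p (phi X g e) q else [::].

Fixpoint phi_p g p : G := if p is e :: q then phi_p (phi X g e) q else g.

Definition strongly_fixed g p :=
  [/\ p <> [::], is_path p, act_p g p = p & phi_p g p = 1].

Definition SF A g : set (seq (edge U)) :=
  [set p | strongly_fixed g p /\ path_rng p `<=` A].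

Definition SF_minimal A g : set (seq (edge U)) :=
  [set p | SF A g p /\
     forall q r, p = q ++ r -> r <> [::] -> ~ strongly_fixed g q].

Lemma act_s1 A : act_s 1 A = A.
Proof.
rewrite /act_s (_ : act_v X 1 = id) ?image_id //.
by apply/funext => v; rewrite act_v1.
Qed.

Lemma act_sM g h A : act_s (g * h) A = act_s g (act_s h A).
Proof.
by rewrite /act_s image_comp; congr image; apply/funext => v; rewrite act_vM.
Qed.

Lemma act_sK g A : act_s g^-1 (act_s g A) = A.
Proof. by rewrite -act_sM mulVg act_s1. Qed.

Lemma act_sKV g A : act_s g (act_s g^-1 A) = A.
Proof. by rewrite -act_sM mulgV act_s1. Qed.

Lemma act_sS g A B : act_s g A `<=` act_s g B <-> A `<=` B.
Proof.
split=> [|AB]; last exact: image_subset.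
by move=> /(@image_subset _ _ (act_v X g^-1)); rewrite -!/(act_s _ _) !act_sK.
Qed.

Lemma act_vK g : cancel (act_v X g) (act_v X g^-1).
Proof. by move=> v; rewrite -act_vM mulVg act_v1. Qed.

Lemma act_v_inj g : injective (act_v X g).
Proof. exact: can_inj (act_vK g). Qed.

Lemma act_sI g A B : act_s g (A `&` B) = act_s g A `&` act_s g B.
Proof.
apply/seteqP; split=> [_ [v [Av Bv] <-]|w [[v Av <-] [v' Bv' /act_v_inj vv]]].
  by split; exists v.
by subst v'; exists v.
Qed.

Lemma act_sT g : act_s g setT = setT.
Proof.
apply/seteqP; split=> // v _; exists (act_v X g^-1 v) => //.
by rewrite -act_vM mulgV act_v1.
Qed.

Lemma act_s_neq0 g A : act_s g A !=set0 <-> A !=set0.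
Proof.
by split=> [[_ [v Av _]]|[v Av]]; [exists v|exists (act_v X g v); exists v].
Qed.

Lemma genset_act g A : genset A -> genset (act_s g A).
Proof.
move=> gA; elim: gA => {A} [|v|e|A B _ gA _ gB|A B _ gA _ gB|A B _ gA _ gB].
- by rewrite /act_s image_set0; exact: genset0.
- by rewrite /act_s image_set1; exact: genset1.
- by rewrite /act_s -act_src; exact: genset_src.
- by rewrite act_sI; exact: gensetI.
- by rewrite /act_s image_setU; exact: gensetU.
- have -> : act_s g (A `\` B) = act_s g A `\` act_s g B; last exact: gensetD.
  apply/seteqP; split=> [_ [v [Av Bv] <-]|_ [[v Av <-] nB]].
    by split; [exists v|move=> [v' Bv' /act_v_inj vv]; apply: Bv; rewrite -vv].
  by exists v => //; split=> // Bv; apply: nB; exists v.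
Qed.

Lemma phi1 e : phi X 1 e = 1.
Proof.
have := phiM X 1 1 e; rewrite mulg1 act_e1 => H.
by apply: (@mulgI _ (phi X 1 e)); rewrite mulg1 -H.
Qed.

Lemma act_p1 p : act_p 1 p = p.
Proof. by elim: p => //= e p IH; rewrite act_e1 phi1 IH. Qed.

Lemma phi_p1 p : phi_p 1 p = 1.
Proof. by elim: p => //= e p IH; rewrite phi1. Qed.

Lemma act_pM g h p : act_p (g * h) p = act_p g (act_p h p).
Proof. by elim: p g h => //= e p IH g h; rewrite act_eM phiM IH. Qed.

Lemma phi_pM g h p : phi_p (g * h) p = phi_p g (act_p h p) * phi_p h p.
Proof. by elim: p g h => //= e p IH g h; rewrite phiM IH. Qed.

Lemma act_p_cat g p q : act_p g (p ++ q) = act_p g p ++ act_p (phi_p g p) q.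
Proof. by elim: p g => //= e p IH g; rewrite IH. Qed.

Lemma phi_p_cat g p q : phi_p g (p ++ q) = phi_p (phi_p g p) q.
Proof. by elim: p g => //= e p IH g. Qed.

Lemma act_pK g p : act_p g^-1 (act_p g p) = p.
Proof. by rewrite -act_pM mulVg act_p1. Qed.

Lemma act_pKV g p : act_p g (act_p g^-1 p) = p.
Proof. by rewrite -act_pM mulgV act_p1. Qed.

Lemma phi_pV g p : phi_p g^-1 (act_p g p) = (phi_p g p)^-1.
Proof.
apply: (@mulIg _ (phi_p g p)); rewrite mulVg -phi_pM mulVg.
exact: phi_p1.
Qed.

Lemma act_p_nil g p : act_p g p <> [::] <-> p <> [::].
Proof. by case: p. Qed.

Lemma path_rng_act g p : path_rng (act_p g p) = act_s g (path_rng p).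
Proof. by case: p => [|e p] /=; rewrite ?act_sT ?act_rng. Qed.

Lemma path_src_act g p :
  act_s (phi_p g p) (path_src p) `<=` path_src (act_p g p).
Proof.
case: p => [|e p] /=; first by rewrite act_sT.
elim: p g e => [|f p IH] g e /=; last exact: IH.
by rewrite act_src; exact: phi_src.
Qed.

Lemma is_path_act g p : is_path p -> is_path (act_p g p).
Proof.
elim: p g => //= e p IH g [ep pp]; split; last exact: IH.
case: p ep {IH pp} => //= f p fe; rewrite act_rng act_src.
by apply: (@subset_trans _ (act_v X (phi X g e) @` src e));
  [exact: image_subset|exact: phi_src].
Qed.

Definition quad_ok (al : seq (edge U)) (A : set (vertex U)) (g : G)
    (be : seq (edge U)) :=
  [/\ is_path al, is_path be, genset A, A !=set0 &
      A `<=` path_src al `&` act_s g (path_src be)].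

Record quad := Quad {
  q_left : seq (edge U);
  q_set : set (vertex U);
  q_elt : G;
  q_right : seq (edge U);
  quadP : quad_ok q_left q_set q_elt q_right
}.

Lemma quad_ext (x y : quad) : q_left x = q_left y -> q_set x = q_set y ->
  q_elt x = q_elt y -> q_right x = q_right y -> x = y.
Proof.
case: x y => [al A g be ok] [al' A' g' be' ok'] /= E1 E2 E3 E4.
by subst; congr Quad; exact: Prop_irrelevance.
Qed.

Lemma quad_star_ok al A g be : quad_ok al A g be ->
  quad_ok be (act_s g^-1 A) g^-1 al.
Proof.
move=> [pa pb gA A0 AS]; split=> //; first exact: genset_act.
  exact/act_s_neq0.
by rewrite -[X in X `&` _](act_sK g) -act_sI; apply/act_sS; rewrite setIC.
Qed.

Definition quad_star (x : quad) : quad := Quad (quad_star_ok (quadP x)).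

(* The three cases in which (al, A, g, be) (ga, B, h, de) is nonzero; they
   exclude each other, and the first two determine ep. *)
Definition mul_case1 A g be (ga ep : seq (edge U)) :=
  [/\ ga = be ++ ep, ep <> [::] & act_s g (path_rng ep) `<=` A].

Definition mul_case2 be ga B (ep : seq (edge U)) :=
  [/\ be = ga ++ ep, ep <> [::] & path_rng ep `<=` B].

Definition mul_case3 A g (be ga : seq (edge U)) B :=
  ga = be /\ A `&` act_s g B !=set0.

Section Product.
Variables (al be ga de : seq (edge U)) (A B : set (vertex U)) (g h : G).
Hypotheses (okx : quad_ok al A g be) (oky : quad_ok ga B h de).

Lemma mul_case1_ok ep : mul_case1 A g be ga ep ->
  quad_ok (al ++ act_p g ep)
          (path_src (act_p g ep) `&` act_s (phi_p g ep) B)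
          (phi_p g ep * h) de.
Proof.
have [pa pb gA A0 AS] := okx; have [pc pd gB B0 BS] := oky.
move=> [E ep0 epA]; rewrite E in pc BS.
have gep0 : act_p g ep <> [::] by apply/act_p_nil.
have Bs : act_s (phi_p g ep) B `<=` path_src (act_p g ep).
  apply: subset_trans (@path_src_act g ep); apply/act_sS => v /BS[].
  by rewrite path_src_cat.
split=> //.
- apply: is_path_cat => //; first exact: is_path_act (is_path_catr pc).
  by rewrite path_rng_act => v /epA/AS[].
- by apply: gensetI; [exact: genset_path|exact: genset_act].
- by rewrite setIidr //; apply/act_s_neq0.
- rewrite path_src_cat // act_sM; apply: setIS; apply/act_sS => v /BS[] //.
Qed.

Lemma mul_case2_sub ep : mul_case2 be ga B ep ->
  A `<=` act_s (g * (phi_p h^-1 ep)^-1) (path_src (act_p h^-1 ep)).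
Proof.
have [_ _ _ _ AS] := okx; move=> [E ep0 _]; rewrite E in AS.
apply: (@subset_trans _ (act_s g (path_src ep))).
  by move=> v /AS[]; rewrite path_src_cat.
rewrite act_sM; apply/act_sS.
by rewrite -[X in X `<=` _](act_sK (phi_p h^-1 ep)); apply/act_sS/path_src_act.
Qed.

Lemma mul_case2_ok ep : mul_case2 be ga B ep ->
  quad_ok al
          (A `&` act_s (g * (phi_p h^-1 ep)^-1) (path_src (act_p h^-1 ep)))
          (g * (phi_p h^-1 ep)^-1) (de ++ act_p h^-1 ep).
Proof.
have [pa pb gA A0 AS] := okx; have [pc pd gB B0 BS] := oky.
move=> c2; have [E ep0 epB] := c2; rewrite E in pb AS.
have hep0 : act_p h^-1 ep <> [::] by apply/act_p_nil.
have As := mul_case2_sub c2.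
split=> //.
- apply: is_path_cat => //; first exact: is_path_act (is_path_catr pb).
  rewrite path_rng_act -[path_src de](act_sK h).
  by apply/act_sS => v /epB /BS[].
- by apply: gensetI => //; apply/genset_act/genset_path.
- by rewrite setIidl.
- by rewrite path_src_cat // => v [/AS[]].
Qed.

Lemma mul_case3_ok : mul_case3 A g be ga B ->
  quad_ok al (A `&` act_s g B) (g * h) de.
Proof.
have [pa pb gA A0 AS] := okx; have [pc pd gB B0 BS] := oky.
move=> [_ AB0]; split=> //; first by apply: gensetI => //; exact: genset_act.
apply: setISS; first by move=> v /AS[].
by rewrite act_sM; apply/act_sS => v /BS[].
Qed.

End Product.

Definition quad_mul (x y : quad) : option quad :=
  let: Quad al A g be okx := x in
  let: Quad ga B h de oky := y in
  if pselect (exists ep, mul_case1 A g be ga ep) is left H1 then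
    let ep := sval (cid H1) in
    Some (@Quad (al ++ act_p g ep)
                (path_src (act_p g ep) `&` act_s (phi_p g ep) B)
                (phi_p g ep * h)
                de
                (mul_case1_ok okx oky (svalP (cid H1))))
  else if pselect (exists ep, mul_case2 be ga B ep) is left H2 then
    let ep := sval (cid H2) in
    Some (@Quad al
                (A `&` act_s (g * (phi_p h^-1 ep)^-1)
                             (path_src (act_p h^-1 ep)))
                (g * (phi_p h^-1 ep)^-1)
                (de ++ act_p h^-1 ep)
                (mul_case2_ok okx oky (svalP (cid H2))))
  else if pselect (mul_case3 A g be ga B) is left H3 then
    Some (@Quad al (A `&` act_s g B) (g * h) de (mul_case3_ok okx oky H3))
  else None.

(* [None] is the zero element. *)
Definition ug_semigroup := option quad.

Definition ug_mul (x y : ug_semigroup) : ug_semigroup :=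
  if x is Some q then if y is Some r then quad_mul q r else None else None.

Definition ug_star (x : ug_semigroup) : ug_semigroup := omap quad_star x.

(* The inverse semigroup axioms are proved through a faithful representation:
   (al, A, g, be) acts as the partial injection
   (be p, v, k) |-> (al (g p), phi(g, p) v, phi(g, p) k). *)

Definition entry p v : set (vertex U) := if p is e :: _ then rng e else [set v].

Lemma entry_act g p v : 
  entry (act_p g p) (act_v X (phi_p g p) v) = act_s g (entry p v).
Proof. by case: p => [|e p] /=; rewrite ?act_rng // /act_s image_set1. Qed.

Lemma entry_neq0 p v : entry p v !=set0.
Proof.
by case: p => [|e p] /=; [exists v|have [w ->] := rng_set1 e; exists w].
Qed.

Lemma entry_cat p q v : p <> [::] -> entry (p ++ q) v = path_rng p.
Proof. by case: p. Qed.

Definition triple := (seq (edge U) * vertex U * G)%type.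

Definition quad_rep (x : quad) (z w : triple) := exists p,
  [/\ z.1.1 = q_right x ++ p,
      w = (q_left x ++ act_p (q_elt x) p, act_v X (phi_p (q_elt x) p) z.1.2,
           phi_p (q_elt x) p * z.2) &
      act_s (q_elt x) (entry p z.1.2) `<=` q_set x].

Definition rep (x : ug_semigroup) (z w : triple) :=
  if x is Some q then quad_rep q z w else False.

Lemma cat_inj p q q' : p ++ q = p ++ q' -> q = q'.
Proof. by elim: p => //= e p IH [/IH]. Qed.

Lemma rep_fun x z w w' : rep x z w -> rep x z w' -> w = w'.
Proof.
case: x => //= x [p [zp -> _]] [q [zq -> _]].
by rewrite zp in zq; rewrite (cat_inj zq).
Qed.

Lemma quad_starK x : quad_star (quad_star x) = x.
Proof. by apply: quad_ext => //=; rewrite invgK // act_sKV. Qed.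

Lemma ug_starK x : ug_star (ug_star x) = x.
Proof. by case: x => //= x; rewrite quad_starK. Qed.

Lemma rep_starW x z w : rep x z w -> rep (ug_star x) w z.
Proof.
case: x z => //= x [[zp v] k] [p /= [-> -> pA]]; set g := q_elt x in pA *.
exists (act_p g p); split=> //=.
  by rewrite act_pK phi_pV act_vK mulKg.
by rewrite entry_act act_sK -[X in X `<=` _](act_sK g); apply/act_sS.
Qed.

Lemma rep_star x z w : rep (ug_star x) w z <-> rep x z w.
Proof. by split=> /rep_starW //; rewrite ug_starK. Qed.

Lemma rep_inj x z z' w : rep x z w -> rep x z' w -> z = z'.
Proof. by move=> /rep_starW H /rep_starW; exact: rep_fun H. Qed.

Lemma quad_rep_point (x : quad) v k : q_set x (act_v X (q_elt x) v) ->
  quad_rep x (q_right x, v, k)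
             (q_left x, act_v X (q_elt x) v, q_elt x * k).
Proof.
move=> xv; exists [::]; rewrite /= !cats0; split=> //.
by rewrite /act_s image_set1 => _ ->.
Qed.

Lemma quad_set_point (x : quad) : exists v, q_set x (act_v X (q_elt x) v).
Proof.
have [_ _ _ [v Av] _] := quadP x.
by exists (act_v X (q_elt x)^-1 v); rewrite -act_vM mulgV act_v1.
Qed.

Lemma quad_rep_right (x y : quad) :
  (forall z w, quad_rep x z w -> quad_rep y z w) ->
  exists p, q_right x = q_right y ++ p.
Proof.
move=> xy; have [v xv] := quad_set_point x.
by have [p [/= E _ _]] := xy _ _ (quad_rep_point 1 xv); exists p.
Qed.

Lemma rep_eq x y : (forall z w, rep x z w <-> rep y z w) -> x = y.
Proof.
case: x y => [x|] [y|] //= xy; last 2 first.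
- by have [v xv] := quad_set_point x; have /xy := quad_rep_point 1 xv.
- by have [v yv] := quad_set_point y; have /xy := quad_rep_point 1 yv.
have R : q_right x = q_right y.
  have [|p Ep] := @quad_rep_right x y; first by move=> z w /xy.
  have [|q Eq] := @quad_rep_right y x; first by move=> z w /xy.
  rewrite Eq -catA in Ep; have : q ++ p = [::].
    by apply: (@cat_inj (q_right x)); rewrite cats0 -Ep.
  by case: q Eq {Ep} => // -> _; rewrite cats0.
have K v : q_set x (act_v X (q_elt x) v) ->
  [/\ q_left x = q_left y, q_elt x = q_elt y & q_set y (act_v X (q_elt x) v)].
  move=> /(quad_rep_point 1)/xy [p [/= E + pA]].
  have p0 : p = [::] by apply: (@cat_inj (q_right y)); rewrite cats0 -E.
  subst p; rewrite /= !cats0 !mulg1 => -[L1 _ E1]; rewrite -E1 in pA.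
  by split=> //; apply: pA; exists v.
have [v0 xv0] := quad_set_point x; have [L E _] := K v0 xv0.
congr Some; apply: quad_ext => //; apply/seteqP; split=> v Av.
  have Ev : v = act_v X (q_elt x) (act_v X (q_elt x)^-1 v).
    by rewrite -act_vM mulgV act_v1.
  by rewrite Ev; have [|_ _] := K (act_v X (q_elt x)^-1 v); rewrite -?Ev.
have Ev : v = act_v X (q_elt y) (act_v X (q_elt y)^-1 v).
  by rewrite -act_vM mulgV act_v1.
rewrite Ev in Av.
have /xy [p [/= E' _ pA]] := quad_rep_point 1 Av.
have p0 : p = [::] by apply: (@cat_inj (q_right x)); rewrite cats0 -E'.
by subst p; rewrite Ev -{1}E; apply: pA; exists (act_v X (q_elt y)^-1 v).
Qed.

Lemma cat_split p q p' q' : p ++ q = p' ++ q' -> 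
  [\/ exists2 r, r <> [::] & p' = p ++ r /\ q = r ++ q',
      p = p' /\ q = q' |
      exists2 r, r <> [::] & p = p' ++ r /\ q' = r ++ q].
Proof.
elim: p p' => [|e p IH] [|e' p'] /=.
- by move=> ->; constructor 2.
- by move=> ->; constructor 1; exists (e' :: p').
- by move=> <-; constructor 3; exists (e :: p).
- move=> [<- /IH [[r r0 [-> ->]]|[-> ->]|[r r0 [-> ->]]]].
  + by constructor 1; exists r.
  + by constructor 2.
  + by constructor 3; exists r.
Qed.

Lemma cat_neq p r : r <> [::] -> p <> p ++ r.
Proof. by move=> r0; rewrite -{1}[p]cats0 => /cat_inj /esym. Qed.

Lemma rep_mul x y z w :
  rep (ug_mul x y) z w <-> exists2 u, rep y z u & rep x u w.
Proof.
case: x y => [x|] [y|]; try by split=> // -[].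
case: x => [al A g be okx]; case: y => [ga B h de oky].
have [pa pb gA A0 AS] := okx; have [pc pd gB B0 BS] := oky.
case: z => [[zp v] k]; rewrite /= /quad_mul.
case: pselect => [H1|H1].
  case: (cid H1) => /= ep c1; move: (mul_case1_ok _ _ _) => ok.
  have [Ega ep0 epA] := c1.
  split=> [[p [/= -> -> pB]]|[u [q [/= -> -> qB]] [p /= [Ep -> pA]]]].
    exists (ga ++ act_p h p, act_v X (phi_p h p) v, phi_p h p * k).
      exists p; split=> //=.
      apply/(@act_sS (phi_p g ep)); rewrite -act_sM.
      by move=> t /pB[].
    exists (ep ++ act_p h p); split=> /=.
    - by rewrite Ega catA.
    - by rewrite act_p_cat phi_p_cat act_pM phi_pM -catA act_vM mulgA.
    - by rewrite entry_cat.
  move: Ep; rewrite Ega -catA => /cat_inj Ep; subst p.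
  exists q; split=> //=.
    by rewrite act_p_cat phi_p_cat act_pM phi_pM -catA act_vM mulgA.
  rewrite act_sM subsetI; split; last exact/act_sS.
  apply: subset_trans (@path_src_act g ep); apply/act_sS => t /qB/BS[].
  by rewrite Ega path_src_cat.
case: pselect => [H2|H2].
  case: (cid H2) => /= ep c2; move: (mul_case2_ok _ _ _) => ok.
  have [Ebe ep0 epB] := c2.
  set ph := phi_p h^-1 ep in ok *; set ep' := act_p h^-1 ep in ok *.
  have hep : act_p h ep' = ep by rewrite act_pKV.
  have hph : phi_p h ep' = ph^-1 by rewrite -[h]invgK phi_pV.
  have ep'0 : ep' <> [::] by apply/act_p_nil.
  have E p : (al ++ act_p (g * ph^-1) p, act_v X (phi_p (g * ph^-1) p) v,
              phi_p (g * ph^-1) p * k) =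
             (al ++ act_p g (act_p ph^-1 p),
              act_v X (phi_p g (act_p ph^-1 p)) (act_v X (phi_p ph^-1 p) v),
              phi_p g (act_p ph^-1 p) * (phi_p ph^-1 p * k)) :> triple.
    by rewrite act_pM phi_pM act_vM mulgA.
  split=> [[p [/= -> -> pB]]|[u [q [/= -> -> qB]] [p /= [Ep -> pA]]]].
    exists (ga ++ act_p h (ep' ++ p), act_v X (phi_p h (ep' ++ p)) v,
            phi_p h (ep' ++ p) * k).
      exists (ep' ++ p); split=> //=; first by rewrite catA.
      by rewrite entry_cat // -path_rng_act hep.
    exists (act_p ph^-1 p); rewrite act_p_cat phi_p_cat hep hph; split=> //=.
    - by rewrite Ebe catA.
    - by rewrite entry_act -act_sM => t /pB[].
  move: Ep; rewrite Ebe -catA => /cat_inj Ep.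
  have Eq : q = ep' ++ act_p ph p.
    by rewrite -(act_pK h q) Ep act_p_cat.
  subst q; rewrite act_p_cat phi_p_cat hep hph act_pK in Ep pA *.
  exists (act_p ph p); split=> //=.
  - by rewrite catA.
  - by rewrite E act_pK.
  - have pA' : act_s (g * ph^-1) (entry (act_p ph p) v) `<=` A.
      by rewrite act_sM -entry_act act_pK.
    rewrite subsetI; split=> //; apply: subset_trans pA' _.
    by apply: mul_case2_sub; [exact: okx|exact: c2].
case: pselect => [H3|H3].
  move: (mul_case3_ok _ _ _) => ok; have [Ega _] := H3; subst ga.
  split=> [[p [/= -> -> pB]]|[u [q [/= -> -> qB]] [p /= [Ep -> pA]]]].
    exists (be ++ act_p h p, act_v X (phi_p h p) v, phi_p h p * k).
      exists p; split=> //=; apply/(@act_sS g); rewrite -act_sM.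
      by move=> t /pB[].
    exists (act_p h p); split=> //=.
      by rewrite act_pM phi_pM act_vM mulgA.
    by rewrite entry_act -act_sM => t /pB[].
  move/cat_inj: Ep => Ep; subst p; exists q; split=> //=.
    by rewrite act_pM phi_pM act_vM mulgA.
  rewrite subsetI act_sM; split; last exact/act_sS.
  by rewrite -entry_act.
split=> // -[u [q [/= _ -> qB]] [p /= [Ep _ pA]]].
case: (cat_split Ep) => [[r r0 [Er Eq]]|[Er Eq]|[r r0 [Er Eq]]].
- apply: H2; exists r; split=> //.
  by rewrite -(entry_cat p (act_v X (phi_p h q) v) r0) -Eq entry_act.
- apply: H3; split=> //; have [t qt] := entry_neq0 q v.
  exists (act_v X g (act_v X h t)); split.
    by apply: pA; rewrite -Eq entry_act; exists (act_v X h t) => //; exists t.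
  by exists (act_v X h t) => //; apply: qB; exists t.
- apply: H1; exists r; split=> //.
  by move: pA; rewrite Eq entry_cat.
Qed.

Lemma ug_mulA : associative ug_mul.
Proof.
move=> x y t; apply: rep_eq => z w; split.
  by move=> /rep_mul[u /rep_mul[u' tu yu] xu]; apply/rep_mul; exists u' => //;
    apply/rep_mul; exists u.
by move=> /rep_mul[u tu /rep_mul[u' yu xu]]; apply/rep_mul; exists u' => //;
  apply/rep_mul; exists u.
Qed.

Lemma ug_mul_starK x : ug_mul (ug_mul x (ug_star x)) x = x.
Proof.
apply: rep_eq => z w; split=> [/rep_mul[u xu /rep_mul[u' /rep_star xu' xw]]|xw].
  by rewrite (rep_inj xu xu').
by apply/rep_mul; exists w => //; apply/rep_mul; exists z => //; exact/rep_star.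
Qed.

Lemma ug_star_mulK x : ug_mul (ug_mul (ug_star x) x) (ug_star x) = ug_star x.
Proof. by rewrite -{2}[x]ug_starK ug_mul_starK. Qed.

Lemma ug_star_unique x y : ug_mul (ug_mul x y) x = x ->
  ug_mul (ug_mul y x) y = y -> y = ug_star x.
Proof.
move=> xyx yxy; apply: rep_eq => z w; split=> [yw|/rep_star xz].
  have := yw; rewrite -{1}yxy => /rep_mul[u yu /rep_mul[u' xu yu']].
  by apply/rep_star; have <- := rep_fun yu yw; have <- := rep_inj yu' yw.
have := xz; rewrite -{1}xyx => /rep_mul[u xu /rep_mul[u' yu xu']].
by have <- := rep_fun xu xz; have <- := rep_inj xu' xz.
Qed.

Lemma ug_mul0 x : ug_mul None x = None. Proof. by []. Qed.

Lemma ug_mulr0 x : ug_mul x None = None. Proof. by case: x. Qed.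

HB.instance Definition _ := gen_eqMixin ug_semigroup.
HB.instance Definition _ := gen_choiceMixin ug_semigroup.
HB.instance Definition _ := isSemigroup.Build ug_semigroup ug_mulA.
HB.instance Definition _ := isInverseSemigroup0.Build ug_semigroup
  ug_mul_starK ug_star_mulK ug_star_unique ug_mul0 ug_mulr0.

End SelfSimilar.

(* Main.v *)
Require Import Defs.
From mathcomp Require Import all_boot.
From mathcomp Require Import all_classical topology.

Local Open Scope classical_set_scope.
Local Open Scope group_scope.

(** Why the theorem holds.

    Two germs over different filters are separated because some idempotent
    belongs to only one of the filters.  Two distinct germs [s, F] and [t, F]
    over the same filter are the problem: they may fail to be separated when
    s and t agree near filters accumulating at F.  Now s and t agree on a
    neighbourhood of F exactly when some idempotent below r = t^* s lies in F.
    Call a set D of idempotents below r a cover if each nonzero idempotent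
    below r meets an element of D.  A tight filter which contains an
    idempotent below r must contain an element of any finite cover
    ([tight_cover]), so finitely many clopen conditions decide whether the
    germs of s and t coincide.  Hence a finite cover for each r yields the
    Hausdorff property ([finite_cover_hausdorff]).

    It remains to find a finite cover for r = (alpha, A, g, beta).  Inspecting
    the partial injections that represent the semigroup, a nonzero idempotent
    below r exists only if alpha = beta, and it is then supported on a path
    alpha p with p either empty or strongly fixed by g, of range inside A
    ([idem_below_quad]).  The empty p forces g = 1, and then r is idempotent
    and covers itself.  When g <> 1, each such p extends a minimal strongly
    fixed path eta, and the idempotents (alpha eta, s(eta), 1, alpha eta)
    indexed by the minimal eta form a cover.  It is finite because A lies in a
    finite union of singletons and sources of edges
    ([finite_SF_minimal_genset]). *)

(** * Finite covers and Hausdorff groupoids of germs *)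

Section FiniteCovers.
Set Implicit Arguments.
Unset Strict Implicit.
Variable S : inverseSemigroup0Type.
Implicit Types (r s t e f : S) (F K : tight S) (D : set S).

(** For an idempotent f, the equation r * f = f says that f lies below r in the
    natural order. *)
Definition idem_cover r D :=
  (forall f, D f -> idem f /\ r * f = f) /\
  (forall e, idem e -> e <> szero -> r * e = e ->
     exists2 f, D f & e * f <> szero).

(** Maximality: if f met every element of F, then F and f would together
    generate a larger filter avoiding zero. *)
Lemma ultrafilter_disjoint (F : efilter S) f : ultrafilters F -> idem f ->
  ~ F f -> exists2 x, F x & x * f = szero.
Proof.
move=> uF fi nFf; apply: contrapT => meets.
pose K : set S := [set y | idem y /\ exists2 x, F x & x * f = y * (x * f)].
have K_filter : is_filter K.
  split=> [y []||y z [yi [x Fx xy]] [zi [w Fw wz]]|y z [yi [x Fx xy]] zi yz].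
  - by [].
  - have [_ [x Fx] _ _] := efilter_filter F; exists f; split=> //.
    exists x => //; have xi := filt_idem Fx.
    by rewrite (idemC xi fi) mulgA fi.
  - split; first exact: idemM.
    exists (x * w); first exact: filtM.
    have xi := filt_idem Fx; have wi := filt_idem Fw.
    have xfi := idemM xi fi; have wfi := idemM wi fi.
    have -> : x * w * f = (x * f) * (w * f).
      by rewrite -mulgA -[in RHS]mulgA [f * (w * f)]mulgA (idemC fi wi)
                 -[w * f * f]mulgA fi.
    rewrite {1}xy {1}wz -!mulgA; congr (y * _).
    by rewrite !mulgA (idemC xfi zi) !mulgA.
  - split=> //; exists x => //.
    by move/(natle_idemE yi zi): yz => yz; rewrite {1}xy {1}yz -mulgA -xy.
have K_n0 : ~ K szero.
  by move=> [_ [x Fx]]; rewrite mul0s => xf; apply: meets; exists x.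
apply: nFf; rewrite -(uF (EFilter K_filter K_n0)) /=.
  have [_ [x Fx] _ _] := efilter_filter F; split=> //; exists x => //.
  by rewrite [RHS]mulgA (idemC fi (filt_idem Fx)) -mulgA fi.
move=> e Fe; have ei := filt_idem Fe; split=> //; exists e => //.
by rewrite mulgA ei.
Qed.

(** The elements of F disjoint from the single members of l multiply to an
    element disjoint from all of them. *)
Lemma ultrafilter_disjoint_seq (F : efilter S) (l : seq S) e :
  ultrafilters F -> {in l, forall f, idem f} ->
  (forall f, f \in l -> ~ F f) -> F e ->
  exists2 x, F x & {in l, forall f, e * x * f = szero}.
Proof.
move=> uF; elim: l => [|f l IH] li lF Fe; first by exists e.
have fl : f \in f :: l by rewrite mem_head.
have [||x Fx xl] := IH _ _ Fe.
- by move=> y yl; apply: li; rewrite inE yl orbT.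
- by move=> y yl; apply: lF; rewrite inE yl orbT.
have [y Fy yf] := ultrafilter_disjoint uF (li _ fl) (lF _ fl).
exists (x * y); first exact: filtM.
move=> z; rewrite inE => /orP[/eqP ->|zl].
  by rewrite -!mulgA yf !muls0.
have zi : idem z by apply: li; rewrite inE zl orbT.
by rewrite -!mulgA (idemC (filt_idem Fy) zi) !mulgA xl ?mul0s.
Qed.

(** If F avoided D, then so would an ultrafilter K containing e, because F lies in
    the closure of the ultrafilters.  Maximality of K gives a nonzero idempotent
    e * x below r disjoint from each element of D, against the covering
    property. *)
Lemma tight_cover r D F e : finite_set D -> idem_cover r D ->
  F e -> r * e = e -> exists2 f, D f & F f.
Proof.
move=> /finite_seqP[l ->] [lr cover] Fe re; apply: contrapT => nF.
have li : {in l, forall f, idem f} by move=> f /lr[].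
have ei := filt_idem Fe.
have [|K [uK Ke Kl]] := (tight_spectrumP F).1 (set_valP F) e l ei li Fe.
  by move=> f fl Ff; apply: nF; exists f.
have [x Kx xl] := ultrafilter_disjoint_seq uK li Kl Ke.
have Kex := filtM Ke Kx.
have [|||f fl] := cover (e * x).
- exact: filt_idem Kex.
- by move=> ex0; apply: (efilter_n0 (e := K)); rewrite -ex0.
- by rewrite mulgA re.
- by apply; exact: xl.
Qed.

(** The factor t^* * t is there because e may stick out of the domain of t, where
    t^* * s cannot fix it. *)
Lemma agree_below s t e : idem e -> s * e = t * e ->
  star t * s * (star t * t * e) = star t * t * e.
Proof.
move=> ei st; have ti := idem_starM t.
rewrite (idemC ti ei) -mulgA (mulgA s) st -mulgA [_ * (t * _)]mulgA.
by rewrite -(idemC ti ei) mulgA ti.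
Qed.

(** From e = e * e^* = r * e * r^* one gets e * r = r * e = e,
    whence r^* * e = e by taking adjoints. *)
Lemma below_dom r e : idem e -> r * e = e -> star r * r * e = e.
Proof.
move=> ei re; have conj : e = r * e * star r.
  by rewrite -{1}ei -{2}(star_idem ei) -{2}re starM (star_idem ei) -{1}re
             !mulgA -(mulgA r e e) ei.
have er : e * r = e.
  rewrite {1}conj -!mulgA (idemC ei (idem_starM r)).
  by rewrite !mulgA mul_starK.
by rewrite -mulgA re -{1}(star_idem ei) -starM er star_idem.
Qed.

Lemma below_agree s t e : idem e -> star t * s * e = e -> s * e = t * e.
Proof.
move=> ei re; rewrite -[in RHS]re -{1}(below_dom ei re) starM starK !mulgA.
have -> : s * star s * t * star t * s * e =
   s * (star s * (t * star t) * s) * e by rewrite !mulgA.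
by rewrite -idem_swap ?mulgA //; exact: idem_Mstar.
Qed.

Lemma germ_nbhs_open s (W : set (tight S)) : open W ->
  open (germ_nbhs s (W `&` [set F : tight S | F (star s * s)])).
Proof.
move=> oW; exists [set germ_nbhs s (W `&` [set F : tight S | F (star s * s)])].
  by move=> _ ->; exists s, W.
by rewrite bigcup_set1.
Qed.

Lemma tight_basic_open e (l : seq S) : idem e -> {in l, forall f, idem f} ->
  open [set F : tight S | F e /\ forall f, f \in l -> ~ F f].
Proof.
by move=> ei li; exists (basic_nbhs e l) => //; apply: basic_open; exists e, l.
Qed.

Lemma separate_germs_base (p q : germ_pair S) e :
  germ_filter p e -> ~ germ_filter q e ->
  exists A B : set (tight_groupoid S),
    [/\ open A, open B, A (germ p), B (germ q) & A `&` B = set0].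
Proof.
move=> pe qe; have ei := filt_idem pe.
set s := germ_elt p; set t := germ_elt q.
pose V := [set F : tight S | F e].
pose W := [set F : tight S | F (star t * t) /\ forall f, f \in [:: e] -> ~ F f].
exists (germ_nbhs s (V `&` [set F : tight S | F (star s * s)])),
       (germ_nbhs t (W `&` [set F : tight S | F (star t * t)])); split.
- by apply/germ_nbhs_open/tight_open.
- apply/germ_nbhs_open/tight_basic_open; first exact: idem_starM.
  by move=> f; rewrite inE => /eqP ->.
- by exists p => //; split=> //; split=> //; exact: germ_dom.
- exists q => //; split=> //; split; last exact: germ_dom.
  by split=> [|f]; [exact: germ_dom|rewrite inE => /eqP ->].
- apply/seteqP; split=> // _ [[x [_ [xe _]] <-] [y [_ [[_ ye] _]] /germP[yx _]]].
  by apply: (ye e); rewrite ?mem_head // yx.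
Qed.

(** The elements of a finite cover of t^* s that are missing from the common
    filter cut out a neighbourhood of it on which s and t nowhere agree. *)
Lemma separate_germs_fiber (p q : germ_pair S) D :
  germ_filter p = germ_filter q -> finite_set D ->
  idem_cover (star (germ_elt q) * germ_elt p) D -> germ p <> germ q ->
  exists A B : set (tight_groupoid S),
    [/\ open A, open B, A (germ p), B (germ q) & A `&` B = set0].
Proof.
move=> pq finD coverD npq.
set s := germ_elt p in coverD *; set t := germ_elt q in coverD *.
have nD f : D f -> ~ germ_filter p f.
  move=> Df pf; have [fi rf] := coverD.1 f Df.
  by apply/npq/germP; split=> //; exists f => //; exact: below_agree.
have [l Dl] := (finite_seqP D).1 finD.
have li : {in l, forall f, idem f}.
  by move=> f fl; have [|] := coverD.1 f; rewrite ?Dl.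
have lp f : f \in l -> ~ germ_filter p f by move=> fl; apply: nD; rewrite Dl.
pose V := [set F : tight S | F (star t * t) /\ forall f, f \in l -> ~ F f].
have oV : open V by apply: tight_basic_open => //; exact: idem_starM.
exists (germ_nbhs s (V `&` [set F : tight S | F (star s * s)])),
       (germ_nbhs t (V `&` [set F : tight S | F (star t * t)])); split.
- exact: germ_nbhs_open.
- exact: germ_nbhs_open.
- exists p => //; split=> //; split; last exact: germ_dom.
  by split=> //; rewrite pq; exact: germ_dom.
- exists q => //; split=> //; split; last exact: germ_dom.
  by rewrite /V /= -pq; split=> //; rewrite pq; exact: germ_dom.
- apply/seteqP; split=> // _ [[x [xs [[xt xl] _]] <-] [y [yt _] yx]].
  have /germP[yxF [e ye yxe]] := yx.
  rewrite yt xs in yxe; rewrite yxF in ye.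
  have ei := filt_idem ye.
  have [f Df xf] := tight_cover finD coverD (filtM xt ye)
                      (agree_below ei (esym yxe)).
  by apply: (xl f) => //; move: Df; rewrite Dl.
Qed.

Theorem finite_cover_hausdorff :
  (forall r, exists2 D, finite_set D & idem_cover r D) ->
  hausdorff_space (tight_groupoid S).
Proof.
move=> covers; rewrite open_hausdorff => a b; rewrite -[a]germ_repr -[b]germ_repr.
set p := repr a; set q := repr b => /eqP pq.
have [A [B [oA oB Ap Bq AB]]] : exists A B : set (tight_groupoid S),
    [/\ open A, open B, A (germ p), B (germ q) & A `&` B = set0].
  have [Fpq|Fpq] := pselect (germ_filter p = germ_filter q).
    have [D finD coverD] := covers (star (germ_elt q) * germ_elt p).
    exact: separate_germs_fiber coverD pq.
  have [e] : exists e, ~ (germ_filter p e <-> germ_filter q e).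
    by apply/existsNP => H; apply: Fpq; exact: tight_ext.
  have [pe|npe] := pselect (germ_filter p e) => npq.
    by apply: (@separate_germs_base p q e) => // qe; apply: npq.
  have [|A [B [oA oB Aq Bp AB]]] := @separate_germs_base q p e _ npe.
    by apply: contrapT => nqe; apply: npq.
  by exists B, A; split=> //; rewrite setIC.
exists (A, B) => /=; first by split; apply/mem_set.
by split=> //; apply/eqP.
Qed.

End FiniteCovers.

Section SelfSimilarUltragraph.
Set Implicit Arguments.
Unset Strict Implicit.
Variables (G : groupType) (U : ultragraph) (X : self_similar G U).
Implicit Types (g : G) (v : vertex U) (A B : set (vertex U)).
Implicit Types (p q : seq (edge U)) (x e : ug_semigroup X).

(** * Minimal strongly fixed paths *)

(** The shortest strongly fixed prefix is minimal. *)
Lemma SF_prefix_minimal A g p : SF X A g p ->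
  exists q r, p = q ++ r /\ SF_minimal X A g q.
Proof.
move=> [[p0 pp gp phip] pA].
have ex : exists n, `[< strongly_fixed X g (take n p) >].
  by exists (size p); apply/asboolP; rewrite take_size.
case: (ex_minnP ex) => n /asboolP sf nmin.
exists (take n p), (drop n p); rewrite cat_take_drop; split=> //; split.
  split=> //; rewrite -(path_rng_cat (drop n p)) ?cat_take_drop //.
  by case: sf.
move=> q r E r0 qf.
have qn : (size q < n)%N.
  have : (size (take n p) <= n)%N by rewrite size_take_min geq_minl.
  rewrite E size_cat; apply: leq_trans; rewrite -addn1 leq_add2l.
  by case: r r0 {E}.
have qp : take (size q) p = q.
  by rewrite -(cat_take_drop n p) E -catA take_size_cat.
by have := nmin (size q); rewrite qp leqNgt qn => /(_ (asboolT qf)).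
Qed.

Lemma SF_minimal_sub A B g : A `<=` B -> SF_minimal X A g `<=` SF_minimal X B g.
Proof.
by move=> AB p [[sp pA] pmin]; split=> //; split=> //; exact: subset_trans AB.
Qed.

(** Minimality does not depend on A, so the minimal paths for an intersection or
    a difference are among those for its first operand; this is why finiteness
    for vertices and sources of edges propagates to all generated sets. *)
Lemma finite_SF_minimal_genset g :
  (forall v, finite_set (SF_minimal X [set v] g)) ->
  (forall a, finite_set (SF_minimal X (src a) g)) ->
  forall A, genset A -> finite_set (SF_minimal X A g).
Proof.
move=> finv fine A; elim=> {A} [|//|//|A B _ finA _ _|A B _ finA _ finB
  |A B _ finA _ _].
- suff -> : SF_minimal X set0 g = set0 by [].
  apply/seteqP; split=> // -[|a p] [[[//]]] _ _ _ _ pA _.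
  by have [v av] := rng_set1 a; apply: (pA v); rewrite /= av.
- by apply: sub_finite_set finA; apply: SF_minimal_sub; exact: subIsetl.
- apply: (@sub_finite_set _ _ (SF_minimal X A g `|` SF_minimal X B g)).
    (* The range of a path is a single vertex, so it lies in A or in B. *)
    move=> [|a p] [[[//]]] _ pp gp phip pA pmin; have [v av] := rng_set1 a.
    by have [Av|Bv] := pA v (ltac:(by rewrite /= av)); [left|right];
      split=> //; split=> // w /=; rewrite av => ->.
  by rewrite finite_setU.
- by apply: sub_finite_set finA; apply: SF_minimal_sub => v [].
Qed.

(** * Idempotents below an element of the semigroup *)

Lemma rep_idem e z w : idem e -> rep e z w -> z = w.
Proof.
move=> ee zw; have := zw; rewrite -{1}ee => /rep_mul[u zu uw].
have E := rep_fun zw zu; subst u.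
exact: rep_inj zw uw.
Qed.

Lemma idem_nonzero_rep e : idem e -> e <> szero ->
  exists p v, [/\ is_path p, path_src p v & rep e (p, v, 1) (p, v, 1)].
Proof.
case: e => // e ei _; have [v ev] := quad_set_point e.
have H : rep (Some e) _ _ := quad_rep_point 1 ev.
have := rep_idem ei H => -[LR Ev E1].
have [_ pR _ _ eS] := quadP e; exists (q_right e), v; split=> //.
  by have [+ _] := eS _ ev; rewrite -LR -Ev.
by have := H; rewrite -LR -Ev -E1.
Qed.

(** The defining representation of r sends beta p to alpha (g p) and
    multiplies the group component by phi(g, p), while an idempotent below r
    acts as an identity map.  Since g preserves lengths, alpha (g p) = beta p
    forces alpha = beta and g p = p. *)
Lemma idem_below_quad (r : quad X) e p v :
  (Some r : ug_semigroup X) * e = e -> rep e (p, v, 1) (p, v, 1) ->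
  q_left r = q_right r /\
  exists q, [/\ p = q_right r ++ q, act_p X (q_elt r) q = q,
                phi_p X (q_elt r) q = 1 & entry q v `<=` q_set r].
Proof.
move=> re ep.
have /rep_mul[u eu [q [/= pq [pq' _ phiq] qA]]] :
    rep ((Some r : ug_semigroup X) * e) (p, v, 1) (p, v, 1).
  by rewrite re.
have uE := rep_fun eu ep; subst u; rewrite /= in pq qA.
have sz h l : size (act_p X h l) = size l.
  by elim: l h => //= a l IH h; rewrite IH.
have E : size (q_left r) = size (q_right r).
  by have := congr1 size pq'; rewrite {1}pq !size_cat sz => /addIn.
have LR : q_left r = q_right r.
  by rewrite -(take_size_cat (act_p X (q_elt r) q) E) -pq' pq take_size_cat.
have gq : act_p X (q_elt r) q = q.
  by apply: (@cat_inj _ (q_right r)); rewrite -pq -LR.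
have ph1 : phi_p X (q_elt r) q = 1 by rewrite phiq mulg1.
split=> //; exists q; split=> //.
by rewrite -{1}gq -[v](act_v1 X) -{1}ph1 entry_act.
Qed.

Lemma rep_id_idem x : (forall z w, rep x z w -> z = w) -> idem x.
Proof.
move=> xid; apply: rep_eq => z w; split=> [/rep_mul[u zu uw]|zw].
  by rewrite (xid _ _ zu).
by apply/rep_mul; exists w => //; rewrite -{1}(xid _ _ zw).
Qed.

Lemma path_proj_ok p : is_path p /\ p <> [::] -> quad_ok X p (path_src p) 1 p.
Proof.
move=> [pp p0]; split=> //; first exact: genset_path.
  by case: p p0 {pp} => // a p _; exact: src_neq0.
by rewrite act_s1.
Qed.

(** The largest of the idempotents (p, A, 1, p) for a nonempty path p.  Sending
    the other sequences to zero makes this a total function of p, so that the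
    image of a finite set of sequences is a finite set of idempotents. *)
Definition path_proj p : ug_semigroup X :=
  if pselect (is_path p /\ p <> [::]) is left ok
  then Some (Quad (path_proj_ok ok)) else szero.

Lemma rep_path_proj p z w : rep (path_proj p) z w <->
  [/\ is_path p, p <> [::], z = w &
      exists2 q, z.1.1 = p ++ q & entry q z.1.2 `<=` path_src p].
Proof.
case: z => [[zp v] k]; rewrite /path_proj; case: pselect => [ok|nok]; last first.
  by split=> // -[pp p0 _ _]; apply: nok.
case: (ok) => pp p0; split=> [[q /= []]|[_ _ <- [q /= -> qs]]].
  rewrite act_p1 phi_p1 act_v1 mul1g act_s1 => -> -> qs.
  by split=> //; exists q.
by exists q; rewrite /= act_p1 phi_p1 act_v1 mul1g act_s1.
Qed.

Lemma path_proj_idem p : idem (path_proj p).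
Proof. by apply: rep_id_idem => z w /rep_path_proj[]. Qed.

(** On a path (q_right r) p q' the map represented by r only sees the strongly
    fixed prefix p, past which it continues as the identity. *)
Lemma path_proj_below (r : quad X) p :
  q_left r = q_right r -> SF X (q_set r) (q_elt r) p ->
  (Some r : ug_semigroup X) * path_proj (q_right r ++ p) =
  path_proj (q_right r ++ p).
Proof.
move=> LR [[p0 pp gp phip] pA]; set f := path_proj _.
have fr z : rep f z z -> rep (Some r) z z.
  case: z => [[zp v] k] /rep_path_proj[_ _ _ [q /= -> qs]].
  exists (p ++ q); rewrite /= act_p_cat phi_p_cat gp phip act_p1 phi_p1.
  rewrite act_v1 mul1g LR catA entry_cat //; split=> //.
  by rewrite -path_rng_act gp.
apply: rep_eq => z w; split=> [/rep_mul[u fzu ruw]|fzw].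
  have /rep_path_proj[_ _ zu _] := fzu; rewrite zu in fzu *.
  by rewrite -(rep_fun (fr _ fzu) ruw).
have /rep_path_proj[_ _ zw _] := fzw; rewrite zw in fzw *.
by apply/rep_mul; exists w => //; exact: fr.
Qed.

Lemma entry_sub_path_src p q v : p <> [::] -> is_path (p ++ q) ->
  path_src (p ++ q) v -> entry q v `<=` path_src p.
Proof.
case: q => [|b q] p0 pq vs; first by move: vs; rewrite cats0 => vs w /= ->.
case: p p0 pq {vs} => // a p _.
by elim: p a => [|c p IH] a /= [ab pq] //; exact: IH.
Qed.

(** The support of path_proj p contains every continuation of p, in particular
    the path p q, which e fixes. *)
Lemma path_proj_meets e p q v : p <> [::] -> is_path (p ++ q) ->
  path_src (p ++ q) v -> rep e (p ++ q, v, 1) (p ++ q, v, 1) ->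
  e * path_proj p <> szero.
Proof.
move=> p0 pq vs ez ep0.
suff : rep (e * path_proj p) (p ++ q, v, 1) (p ++ q, v, 1) by rewrite ep0.
apply/rep_mul; exists (p ++ q, v, 1) => //; apply/rep_path_proj; split=> //.
  exact: is_path_catl pq.
by exists q => //; exact: entry_sub_path_src.
Qed.

Lemma idem_cover_quad (r : quad X) :
  (forall g, g <> 1 -> forall A, genset A -> finite_set (SF_minimal X A g)) ->
  exists2 D, finite_set D & idem_cover (Some r : ug_semigroup X) D.
Proof.
move=> fin; set R : ug_semigroup X := Some r.
have [LR|nLR] := pselect (q_left r = q_right r); last first.
  exists set0 => //; split=> // e ei e0 re.
  have [p [v [_ _ /(idem_below_quad re)[/nLR]]]] := idem_nonzero_rep ei e0.
  by [].
have [g1|gn1] := pselect (q_elt r = 1).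
  have Ri : idem R.
    apply: rep_id_idem => -[[zp v] k] w [p [/= -> -> _]].
    by rewrite g1 act_p1 phi_p1 act_v1 mul1g LR.
  exists [set R] => //; split=> [f -> //|e ei e0 re].
  by exists R => //; rewrite idemC // re.
have [_ _ gA _ _] := quadP r.
exists ((fun p => path_proj (q_right r ++ p)) @` SF_minimal X (q_set r) (q_elt r)).
  by apply: finite_image; exact: fin.
split=> [_ [p [pSF _] <-]|e ei e0 re].
  by split; [exact: path_proj_idem|exact: path_proj_below].
have [p [v [pp vs ep]]] := idem_nonzero_rep ei e0.
have [_ [q [pq gq phiq qA]]] := idem_below_quad re ep.
(* phi_p sends the empty path to g itself. *)
have q0 : q <> [::] by move=> q0; apply: gn1; rewrite -phiq q0.
have qSF : SF X (q_set r) (q_elt r) q.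
  rewrite pq in pp; split; first by split=> //; exact: is_path_catr pp.
  by case: (q) q0 qA.
have [eta [ze [Eq eta_min]]] := SF_prefix_minimal qSF.
exists (path_proj (q_right r ++ eta)); first by exists eta.
rewrite pq Eq catA in pp vs ep; apply: path_proj_meets vs ep => //.
have [[[eta0 _ _ _] _] _] := eta_min.
by case: (q_right r).
Qed.

End SelfSimilarUltragraph.

Theorem theorem9p5 (G : groupType) (U : ultragraph) (X : self_similar G U)
    (finite_minimal : forall g : G, g <> 1 ->
       (forall v : vertex U, finite_set (SF_minimal X [set v] g)) /\
       (forall e : edge U, finite_set (SF_minimal X (src e) g))) :
  hausdorff_space (tight_groupoid (ug_semigroup X)).
Proof.
apply: finite_cover_hausdorff => -[r|]; last first.
  exists set0 => //; split=> // e ei e0 re; case: e0.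
  by rewrite -re [LHS]mul0s.
apply: idem_cover_quad => g /finite_minimal[finv fine] A.
exact: finite_SF_minimal_genset.
Qed.
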